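(* For every integer $n\ge 1$, $$\sum_{\pi\in \mathcal I^C_{2n}(321)}q^{\mathrm{maj}^+(\pi)}=\sum_{h=0}^{n} \binom{n}{h}_q+(q^n-1)\sum_{h=0}^{n-1} \binom{n-1}{h}_q=\sum_{h=0}^{n} q^{n-h}\binom{n}{h}_q,$$ where $\binom{n}{h}_q$ denotes the Gaussian ($q$-)binomial coefficient.
   Context: A permutation $\pi\in\mathcal S_m$ is centrosymmetric if $\pi(i)+\pi(m+1-i)=m+1$ for all $i$. $\mathcal I^C_m(321)$ is the set of centrosymmetric involutions in $\mathcal S_m$ avoiding the pattern $321$. A descent of $\pi$ is a position $i\in\{1,\dots,m-1\}$ with $\pi(i)>\pi(i+1)$; $\mathrm{Des}(\pi)$ is the set of descents. With $n=\lfloor m/2\rfloor$, $\mathrm{Des}^+(\pi)=\mathrm{Des}(\pi)\cap\{1,\dots,n\}$ and $\mathrm{maj}^+(\pi)=\sum_{i\in\mathrm{Des}^+(\pi)}i$. *)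

(* Defs.v *)
From HB Require Import structures.
From mathcomp Require Import all_boot all_order all_algebra all_fingroup.
Set Implicit Arguments. Unset Strict Implicit. Unset Printing Implicit Defensive.
Import GRing.Theory.
Local Open Scope ring_scope.

(* Permutations of {1..m} are modelled by 'S_m = {perm 'I_m}; position/value
   i (1-based) corresponds to the ordinal i-1. *)

Definition oneline (m : nat) (p : 'S_m) : seq nat :=
  [seq (val (p i)).+1 | i <- enum 'I_m].

(* pi(i) for 1-based position i (1 <= i <= m). *)
Definition pv (m : nat) (p : 'S_m) (i : nat) : nat := nth 0%N (oneline p) i.-1.

Definition centrosymmetric (m : nat) (p : 'S_m) : bool :=
  [forall i : 'I_m, pv p i.+1 + pv p (m.+1 - i.+1) == m.+1]%N.

Definition involution (m : nat) (p : 'S_m) : bool := [forall i : 'I_m, p (p i) == i].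

Definition avoids321 (m : nat) (p : 'S_m) : bool :=
  ~~ [exists i : 'I_m, exists j : 'I_m, exists k : 'I_m,
        [&& (i < j)%N, (j < k)%N, (p j < p i)%N & (p k < p j)%N]].

Definition ICm321 (m : nat) : {set 'S_m} :=
  [set p : 'S_m | [&& centrosymmetric p, involution p & avoids321 p]].

Definition is_descent (m : nat) (p : 'S_m) (i : nat) : bool :=
  [&& (1 <= i)%N, (i <= m.-1)%N & (pv p i.+1 < pv p i)%N].

Definition majp (m : nat) (p : 'S_m) : nat :=
  (\sum_(1 <= i < (m./2).+1 | is_descent p i) i)%N.

(* Gaussian binomial coefficient [n choose k]_q, via the q-Pascal recurrence
   [n+1, k+1]_q = [n, k]_q + q^(k+1) [n, k+1]_q, [n,0]_q = 1, [0,k+1]_q = 0. *)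
Fixpoint qbinom (R : comNzRingType) (q : R) (n k : nat) : R :=
  match n, k with
  | _, 0 => 1
  | 0, _.+1 => 0
  | n'.+1, k'.+1 => qbinom q n' k' + q ^+ k'.+1 * qbinom q n' k'.+1
  end.

(* Main.v *)
Require Import Defs.
From HB Require Import structures.
From mathcomp Require Import all_boot all_order all_algebra all_fingroup.
From mathcomp Require Import zify ring.
Set Implicit Arguments. Unset Strict Implicit. Unset Printing Implicit Defensive.
Import GRing.Theory.
Local Open Scope ring_scope.

(** In a 321-avoiding involution the excedances increase, the weak deficiencies
    increase, and no fixed point lies under an arc [i < p i].  So the involution
    is the nonnesting matching of a Motzkin path (excedance = up, deficiency =
    down, fixed point = flat) whose flat steps are at height 0.
    Centrosymmetry means that the path is symmetric, so its first half of length
    [n] determines it; there every step offers exactly two choices, up or not up.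
    This gives a bijection with the binary words [b] of length [n].  Descents are
    the positions of an up step followed by a non-up step, and step [n+1] mirrors
    step [n], so [maj+] is the major index of the word [b 0].  Conditioning on
    the last letter yields the recurrence
      G_(n+2) = 2 G_(n+1) + (q^(n+1) - 1) G_n
    of the Galois numbers G_n = sum_h [n choose h]_q. *)

(** * Gaussian binomials and Galois numbers *)

Section Gaussian.
Variables (R : comNzRingType) (q : R).

Lemma qbinom0 n : qbinom q n 0 = 1. Proof. by case: n. Qed.

Lemma qbinomS n k :
  qbinom q n.+1 k.+1 = qbinom q n k + q ^+ k.+1 * qbinom q n k.+1.
Proof. by []. Qed.

Lemma qbinom_small n k : (n < k)%N -> qbinom q n k = 0.
Proof.
elim: n k => [|n IHn] [|k] // lt_nk.
by rewrite qbinomS !IHn ?mulr0 ?addr0 //; lia.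
Qed.

(** The q-analogue of [(n - k) C(n, k) = (k + 1) C(n, k + 1)]. It is proved by induction from
    Pascal's rule, since [q - 1] need not be cancellable in [R]. *)
Lemma qbinom_mul_succ n k : (k <= n)%N ->
  (q ^+ (n - k) - 1) * qbinom q n k = (q ^+ k.+1 - 1) * qbinom q n k.+1.
Proof.
elim: n k => [|n IHn] [|k] // le_kn.
- by rewrite subrr mul0r qbinom_small ?mulr0.
- have := IHn 0%N isT; rewrite subn0 !qbinom0 mulr1 => IH.
  rewrite qbinomS !qbinom0 subn0 mulr1 mulrDr mulr1 mulrCA -IH exprS expr1.
  ring.
have {}le_kn : (k <= n)%N by [].
rewrite subSS !qbinomS mulrDr IHn // mulrDr [in RHS]mulrCA.
case: (ltnP k n) => [lt_kn|ge_kn]; last first.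
  have -> : k = n by lia.
  by rewrite subnn !(@qbinom_small n) // !(mulr0, addr0).
rewrite -(IHn k.+1) //.
have -> : (n - k = (n - k.+1).+1)%N by lia.
set e := (n - k.+1)%N; rewrite !exprS; ring.
Qed.

(** The q-analogue of [(n + 1 - h) C(n + 1, h) = (n + 1) C(n, h)]. Summed over [h], it gives the
    second equality of the theorem. *)
Lemma qbinom_absorb n h : (h <= n.+1)%N ->
  (q ^+ (n.+1 - h) - 1) * qbinom q n.+1 h = (q ^+ n.+1 - 1) * qbinom q n h.
Proof.
case: h => [|k] le_kn; first by rewrite subn0 !qbinom0.
have {}le_kn : (k <= n)%N by [].
rewrite subSS qbinomS mulrDr qbinom_mul_succ // mulrCA mulrA -mulrDl.
congr (_ * _); rewrite -[in RHS](subnK le_kn) -addnS exprD; ring.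
Qed.

Definition galois n : R := \sum_(0 <= h < n.+1) qbinom q n h.

Lemma qbinom_sum_weighted n :
  \sum_(0 <= h < n.+2) q ^+ (n.+1 - h) * qbinom q n.+1 h
  = galois n.+1 + (q ^+ n.+1 - 1) * galois n.
Proof.
have -> : galois n = \sum_(0 <= h < n.+2) qbinom q n h.
  by rewrite [RHS]big_nat_recr //= qbinom_small ?addr0.
rewrite mulr_sumr -big_split /=; apply: eq_big_nat => h lt_h.
by rewrite -qbinom_absorb ?mulrBl ?mul1r 1?addrC ?subrK //; lia.
Qed.

(** Pascal's rule puts the weight [q ^+ h.+1] on [qbinom q n h.+1]; [qbinom_mul_succ] trades these
    weights for [q ^+ (n - h)] on [qbinom q n h]. *)
Lemma galoisS n :
  galois n.+1 = galois n + \sum_(0 <= h < n.+1) q ^+ (n - h) * qbinom q n h.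
Proof.
rewrite {1}/galois big_nat_recl // qbinom0.
under eq_bigr => i _ do rewrite qbinomS.
rewrite big_split /= [\sum_(0 <= i < n.+1) q ^+ i.+1 * _]big_nat_recr //=.
rewrite qbinom_small // mulr0 addr0.
have galoisE : galois n = 1 + \sum_(0 <= h < n) qbinom q n h.+1.
  by rewrite /galois big_nat_recl // qbinom0.
have -> : \sum_(0 <= h < n.+1) q ^+ (n - h) * qbinom q n h
    = galois n + \sum_(0 <= h < n) (q ^+ h.+1 - 1) * qbinom q n h.+1.
  rewrite [galois n]big_nat_recr //= big_nat_recr //= subnn mul1r.
  rewrite -[RHS]addrA [qbinom q n n + _]addrC addrA -big_split /=; congr (_ + _).
  apply: eq_big_nat => h lt_h; rewrite -qbinom_mul_succ; last by lia.
  by rewrite mulrBl mul1r addrC subrK.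
have -> : \sum_(0 <= i < n) q ^+ i.+1 * qbinom q n i.+1
    = \sum_(0 <= h < n) (q ^+ h.+1 - 1) * qbinom q n h.+1
      + \sum_(0 <= h < n) qbinom q n h.+1.
  by rewrite -big_split /=; apply: eq_bigr => h _; rewrite mulrBl mul1r subrK.
rewrite -/(galois n) {3}galoisE; ring.
Qed.

Lemma galoisSS n :
  galois n.+2 = galois n.+1 + (galois n.+1 + (q ^+ n.+1 - 1) * galois n).
Proof. by rewrite galoisS qbinom_sum_weighted. Qed.
End Gaussian.

(** * Major index of binary words *)

Section Words.

(* Words are stored reversed: the head of the sequence is the last letter, in
   position [size w], and [c] is the letter that follows it. *)
Fixpoint word_maj (c : bool) (w : seq bool) : nat :=
  if w is x :: w' then ((x && ~~ c) * (size w').+1 + word_maj x w')%N else 0%N.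

Fixpoint rev_word (b : nat -> bool) (k : nat) : seq bool :=
  if k is k'.+1 then b k' :: rev_word b k' else [::].

Lemma size_rev_word b k : size (rev_word b k) == k.
Proof. by elim: k => //= k /eqP->. Qed.

Lemma nth_rev_word b k i : (i < k)%N ->
  nth false (rev_word b k) i = b (k - i.+1)%N.
Proof. by elim: k i => [|k IHk] [|i] //= lt_ik; rewrite ?subn1 // subSS IHk. Qed.

Lemma eq_rev_word b b' k : (forall i, (i < k)%N -> b i = b' i) ->
  rev_word b k = rev_word b' k.
Proof.
elim: k => //= k IHk eq_b; rewrite eq_b // IHk // => i lt_ik.
by apply: eq_b; lia.
Qed.

Lemma rev_word_nth (w : seq bool) :
  rev_word (fun k => nth false w (size w - k.+1)) (size w) = w.
Proof.
apply: (@eq_from_nth _ false); rewrite (eqP (size_rev_word _ _)) // => i lt_i.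
by rewrite nth_rev_word //; congr nth; lia.
Qed.

Lemma word_maj_rev_word b k :
  word_maj (b k) (rev_word b k)
  = (\sum_(0 <= i < k | b i && ~~ b i.+1) i.+1)%N.
Proof.
elim: k => [|k IHk] /=; first by rewrite big_geq.
rewrite big_mkcond big_nat_recr //= -big_mkcond /= -IHk (eqP (size_rev_word _ _)).
by rewrite addnC; case: (b k && _); rewrite ?mul1n ?mul0n.
Qed.

Variables (R : comNzRingType) (q : R).

Definition words_gf c n : R := \sum_(w : n.-tuple bool) q ^+ word_maj c w.

Lemma words_gf0 c : words_gf c 0 = 1.
Proof.
rewrite /words_gf (big_pred1 [tuple]) // => w /=.
by apply/esym/eqP/val_inj/size0nil; rewrite size_tuple.
Qed.

(** Split off the last letter: [true] in position [n.+1] is a descent exactly when [c] is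
    [false]. *)
Lemma words_gfS c n : words_gf c n.+1
  = q ^+ (~~ c * n.+1)%N * words_gf true n + words_gf false n.
Proof.
rewrite /words_gf.
rewrite (reindex (fun xw : bool * n.-tuple bool => [tuple of xw.1 :: xw.2])) /=.
  rewrite -(pair_bigA _ (fun (x : bool) (w : n.-tuple bool) =>
     q ^+ ((x && ~~ c) * (size w).+1 + word_maj x w))) /=.
  rewrite big_bool /= mulr_sumr; congr (_ + _).
  apply: eq_bigr => w _.
  by rewrite size_tuple exprD.
exists (fun w => (thead w, [tuple of behead w])) => [[x w] _ | w _] /=.
  by congr pair; apply: val_inj.
by rewrite -tuple_eta.
Qed.

Lemma words_gf_true n : words_gf true n = galois q n.
Proof.
have galois0 : galois q 0 = 1 by rewrite /galois big_nat1.
have galois1 : galois q 1 = 1 + 1.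
  by rewrite galoisS big_nat1 galois0 !mul1r.
(* The Galois recurrence has order two, so the induction carries two consecutive values. *)
suff [] : words_gf true n = galois q n /\ words_gf true n.+1 = galois q n.+1 by [].
elim: n => [|n [IH0 IH1]].
  by rewrite words_gfS !words_gf0 mul0n mul1r galois0 galois1.
split=> //; rewrite words_gfS mul0n expr0 mul1r IH1 galoisSS; congr (_ + _).
rewrite words_gfS mul1n IH0.
(* Splitting the last letter in [IH1] gives [words_gf false n] as [galois q n.+1 - galois q n]. *)
have := IH1; rewrite words_gfS mul0n mul1r IH0 => <-; ring.
Qed.

Lemma words_gf_false n :
  words_gf false n.+1 = galois q n.+1 + (q ^+ n.+1 - 1) * galois q n.
Proof.
have := words_gfS true n; rewrite mul0n mul1r !words_gf_true => eqG.
by rewrite words_gfS mul1n words_gf_true eqG; ring.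
Qed.
End Words.

(** * Involutions avoiding 321 *)

Section Count.
Variable m : nat.
Implicit Types (a : pred 'I_m) (i j : 'I_m).
Local Open Scope nat_scope.

(** For [i] in [a], [count_below a i] is the rank of [i] in [a], counted from 0; a natural number
    [k] also allows the total, at [k = m]. *)
Definition count_below a k := #|[set j | a j & j < k]|.

Lemma count_below0 a : count_below a 0 = 0.
Proof. by apply/eqP; rewrite cards_eq0; apply/eqP/setP => j; rewrite !inE andbF. Qed.

Lemma count_belowS a i : count_below a i.+1 = count_below a i + a i.
Proof.
rewrite /count_below (cardsD1 i) inE ltnS leqnn andbT addnC; congr (_ + _).
apply: eq_card => j; rewrite !inE ltnS [j < i]ltn_neqAle andbCA.
by rewrite -val_eqE /=.
Qed.

Lemma leq_count_below a k l : k <= l -> count_below a k <= count_below a l.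
Proof.
move=> le_kl; apply/subset_leq_card/subsetP => j; rewrite !inE => /andP[-> ltj].
exact: leq_trans ltj le_kl.
Qed.

Lemma eq_count_below a a' k : a =1 a' -> count_below a k = count_below a' k.
Proof. by move=> eq_a; apply: eq_card => j; rewrite !inE eq_a. Qed.

Lemma count_below_rev a k : k <= m ->
  count_below a k + count_below (fun i => a (rev_ord i)) (m - k) = count_below a m.
Proof.
move=> le_km; rewrite [RHS]/count_below -(cardsID [set j : 'I_m | j < k] [set j | a j & j < m]).
rewrite /count_below; congr (_ + _).
  by apply: eq_card => j; rewrite !inE ltn_ord andbT.
rewrite -(card_imset _ (@rev_ord_inj m)); apply: eq_card => j.
apply/imsetP/idP => [[i] | ].
  rewrite !inE => /andP[ai lti] ->; rewrite ai /=; have := ltn_ord i; lia.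
rewrite !inE => /andP[nltj /andP[aj _]]; exists (rev_ord j); rewrite ?rev_ordK //.
rewrite !inE rev_ordK aj /=; have := ltn_ord j; lia.
Qed.

(** The count starts at 0 and grows by one just after each element of [a], so it skips no value. *)
Lemma count_below_onto a r : r < count_below a m ->
  exists2 j, a j & count_below a j = r.
Proof.
suff H k : k <= m -> r < count_below a k -> exists2 j, a j & count_below a j = r.
  exact: H.
elim: k => [|k IHk] lt_km; first by rewrite count_below0.
have := count_belowS a (Ordinal lt_km) => /= ->.
case: (ltnP r (count_below a k)) => [lt_r _|ge_r]; first by apply: IHk => //; lia.
case: (boolP (a _)) => [ak lt_r|_]; last lia.
by exists (Ordinal lt_km) => //=; lia.
Qed.

Lemma count_below_lt a i j : a i -> i < j -> count_below a i < count_below a j.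
Proof.
move=> ai lt_ij; have := leq_count_below a lt_ij.
by rewrite count_belowS ai addn1.
Qed.

Lemma count_below_inj a i j : a i -> a j -> count_below a i = count_below a j ->
  i = j.
Proof.
move=> ai aj eq_c; apply: val_inj => /=; case: (ltngtP i j) => // lt_ij.
  by have := count_below_lt ai lt_ij; rewrite eq_c ltnn.
by have := count_below_lt aj lt_ij; rewrite eq_c ltnn.
Qed.

Lemma leq_count_below_inj a a' (f : 'I_m -> 'I_m) k l : injective f ->
  (forall j, a j -> j < k -> a' (f j) && (f j < l)) ->
  count_below a k <= count_below a' l.
Proof.
move=> f_inj fP; rewrite /count_below -(card_imset _ f_inj); apply/subset_leq_card/subsetP.
by move=> y /imsetP[j]; rewrite !inE => /andP[aj ltj] ->; apply: fP.
Qed.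
End Count.

(** * Excedances of centrosymmetric 321-avoiding involutions *)

Section Pattern.
Variable m : nat.
Implicit Types (p : 'S_m) (i j k : 'I_m).
Local Open Scope nat_scope.

Lemma pvE p i : pv p i.+1 = (p i).+1.
Proof.
by rewrite /pv /oneline (nth_map i) /= ?size_enum_ord // nth_ord_enum.
Qed.

Lemma centrosymmetricP p :
  reflect (forall i, p (rev_ord i) = rev_ord (p i)) (centrosymmetric p).
Proof.
have step i : (pv p i.+1 + pv p (m.+1 - i.+1) == m.+1) = (p (rev_ord i) == rev_ord (p i)).
  have -> : m.+1 - i.+1 = (rev_ord i).+1 by rewrite /=; have := ltn_ord i; lia.
  rewrite !pvE -val_eqE /=; have := ltn_ord (p i); have := ltn_ord (p (rev_ord i)).
  by lia.
by apply: (iffP forallP) => H i; have := H i; rewrite step => /eqP.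
Qed.

Lemma avoids321P p :
  reflect (forall i j k, i < j -> j < k -> p j < p i -> p k < p j -> False)
          (avoids321 p).
Proof.
apply: (iffP negP) => [av i j k ij jk pij pjk | av /existsP[i /existsP[j /existsP[k]]]].
  apply: av; apply/existsP; exists i; apply/existsP; exists j; apply/existsP.
  by exists k; rewrite ij jk pij.
by case/and4P; apply: av.
Qed.

Lemma ICm321P p :
  reflect [/\ forall i, p (rev_ord i) = rev_ord (p i), forall i, p (p i) = i
            & forall i j k, i < j -> j < k -> p j < p i -> p k < p j -> False]
          (p \in ICm321 m).
Proof.
rewrite inE; apply: (iffP and3P) => [[/centrosymmetricP cp /forallP ip /avoids321P ap]|[cp ip ap]].
  by split=> // i; apply/eqP/ip.
split; [exact/centrosymmetricP | by apply/forallP => i; rewrite ip | exact/avoids321P].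
Qed.

Section Elements.
Variables (p : 'S_m) (p_in : p \in ICm321 m).

Let pp i : p (p i) = i. Proof. by case/ICm321P: p_in. Qed.
Let prev i : p (rev_ord i) = rev_ord (p i). Proof. by case/ICm321P: p_in. Qed.
Let p321 i j k : i < j -> j < k -> p j < p i -> p k < p j -> False.
Proof. by case/ICm321P: p_in => _ _; apply. Qed.
Let pneq i j : i < j -> (p i : nat) <> p j.
Proof. by move=> lt_ij /val_inj/perm_inj eq_ij; rewrite eq_ij ltnn in lt_ij. Qed.

(** Otherwise the positions [i < j < p j] carry the values [p i > p j > j]. *)
Lemma excedance_mono i j : i < j -> i < p i -> j < p j -> p i < p j.
Proof.
move=> lt_ij ei ej; case: ltngtP (pneq lt_ij) => // lt_p _.
by case: (p321 lt_ij ej lt_p); rewrite pp.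
Qed.

(** Otherwise, if [p i < i], the positions [p j < p i < i] carry [j > i > p i]; if [p i = i], the
    positions [p j < i < j] carry [j > i > p j]. *)
Lemma nonexcedance_mono i j : i < j -> p i <= i -> p j <= j -> p i < p j.
Proof.
move=> lt_ij ei ej; case: ltngtP (pneq lt_ij) => // lt_p _.
case: (ltngtP (p i) i) ei => // [lt_i|eq_i] _.
  by case: (p321 lt_p lt_i); rewrite !pp.
have lt_pji : p j < i by lia.
by case: (p321 lt_pji lt_ij); rewrite ?pp eq_i.
Qed.

(** Neighbours of equal type ascend by monotonicity. For an excedance followed by a nonexcedance,
    [p i >= j >= p j]; in the opposite order, [p i <= i < j < p j]. *)
Lemma descentE i j : j = i.+1 :> nat -> (p j < p i) = (i < p i) && ~~ (j < p j).
Proof.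
move=> ji; have lt_ij : i < j by rewrite ji.
have := pneq lt_ij; have := @excedance_mono i j lt_ij.
have := @nonexcedance_mono i j lt_ij.
by case: (ltnP i (p i)); case: (ltnP j (p j)); lia.
Qed.

Lemma rev_excedance i : (rev_ord i < p (rev_ord i)) = (p i < i).
Proof. by rewrite prev /=; have := ltn_ord i; have := ltn_ord (p i); lia. Qed.

Let U : pred 'I_m := fun i => i < p i.
Let D : pred 'I_m := fun i => p i < i.

(** [p] injects the deficiencies up to and including [i] into the excedances below [i]. *)
Lemma deficient_count i : D i -> count_below D i < count_below U i.
Proof.
move=> Di; have <- : count_below D i.+1 = (count_below D i).+1.
  by rewrite count_belowS Di addn1.
apply: (leq_count_below_inj (@perm_inj _ p)) => j; rewrite /U /D pp => Dj.
by rewrite Dj /=; lia.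
Qed.

(** An excedance [j < i] with [p j > i] would form a 321 at [j < i < p j], so [p] sends the
    excedances below [i] to deficiencies below [i]. *)
Lemma fixed_count i : p i = i -> count_below U i <= count_below D i.
Proof.
move=> Fi; apply: (leq_count_below_inj (@perm_inj _ p)) => j.
rewrite /U /D pp => Uj lt_ji; rewrite Uj /=.
case: (ltngtP (p j) i) => // [lt_i|]; last first.
  by move/val_inj; rewrite -{1}Fi => /perm_inj eq_ji; rewrite eq_ji ltnn in lt_ji.
by case: (p321 lt_ji lt_i); rewrite ?pp Fi.
Qed.
End Elements.

(* The least excedance on which [p] and [p'] differ is impossible: both map the
   excedances increasingly onto the same set of deficiencies. *)
Lemma excedances_determine p p' : p \in ICm321 m -> p' \in ICm321 m ->
  (forall i, (i < p i) = (i < p' i)) -> (forall i, (p i < i) = (p' i < i)) ->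
  p = p'.
Proof.
have half q q' i : q \in ICm321 m -> q' \in ICm321 m ->
  (forall i, (i < q i) = (i < q' i)) -> (forall i, (q i < i) = (q' i < i)) ->
  (forall j, j < i -> j < q j -> q j = q' j) -> i < q i -> q' i <= q i.
- move=> q_in q'_in eU eD IH Ui; rewrite leqNgt; apply/negP => lt_q.
  have [_ qq _] := ICm321P _ q_in; have [_ qq' _] := ICm321P _ q'_in.
  (* [j] is the excedance that [q'] matches with the deficiency [q i]. Monotonicity puts it before
     [i], and [IH] then gives [q j = q i]. *)
  set j := q' (q i).
  have Uj : j < q' j by rewrite /j qq' -eD qq.
  have lt_ji : j < i.
    case: (ltngtP j i) => // [lt_ij|/val_inj eq_ji].
      have := excedance_mono q'_in lt_ij; rewrite -eU Ui Uj /j qq' => /(_ isT isT).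
      by lia.
    by move: lt_q; rewrite -eq_ji {2}/j qq' eq_ji ltnn.
  have := IH j lt_ji; rewrite eU Uj /j qq' => /(_ isT) /perm_inj eq_ji.
  by move: lt_ji; rewrite /j eq_ji ltnn.
move=> p_in p'_in eU eD.
have [_ pp _] := ICm321P _ p_in; have [_ pp' _] := ICm321P _ p'_in.
have eqU (k : nat) : forall i, i < k -> i < p i -> p i = p' i.
  elim: k => // k IHk i lt_ik Ui; apply/val_inj/eqP; rewrite eqn_leq /=.
  have IH j : j < i -> j < p j -> p j = p' j by move=> lt_ji; apply: IHk; lia.
  apply/andP; split; last by apply: half.
  apply: (half p' p) => // [j lt_ji|]; rewrite -eU // => Uj.
  by rewrite IH.
apply/permP => i; case: (ltngtP i (p i)) => [Ui|Di|/val_inj Fi].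
- exact: (eqU i.+1).
- have : p (p i) = p' (p i) by apply: (eqU (p i).+1) => //; rewrite pp.
  by rewrite pp => {2}->; rewrite pp'.
- apply/val_inj; have := eU i; have := eD i; rewrite -Fi ltnn.
  by case: ltngtP.
Qed.
End Pattern.

(** * Nonnesting matching of a symmetric path *)

Section Matching.
Variables (m : nat) (u : pred 'I_m).
Implicit Types i j k : 'I_m.
Local Open Scope nat_scope.

Let d : pred 'I_m := fun i => u (rev_ord i).

Hypothesis disj : forall i, ~~ (u i && d i).
Hypothesis ballot : forall k : nat, k <= m -> count_below d k <= count_below u k.
Hypothesis flat : forall i, ~~ u i -> ~~ d i -> count_below d i = count_below u i.

(** Joining the opener and the closer of equal rank means first opened, first closed, so no arc
    nests in another. *)
Let arc i j := [&& u i, d j & count_below u i == count_below d j].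

(** The default [i] turns the positions on no arc into fixed points. *)
Definition nonnesting_fun i : 'I_m :=
  odflt i [pick j | arc i j || arc j i].

Let f := nonnesting_fun.

Let total : count_below d m = count_below u m.
Proof.
by have := count_below_rev u (leqnn m); rewrite -(count_below_rev u (leq0n m)) subnn
  subn0 !count_below0 addn0 add0n.
Qed.

Let arc_fun i j : arc i j -> f i = j /\ f j = i.
Proof.
move=> /and3P[ui dj /eqP cij]; rewrite /f /nonnesting_fun.
have ndi : d i = false by have := disj i; rewrite ui; case: (d i).
have nuj : u j = false by have := disj j; rewrite dj andbT; case: (u j).
split; case: pickP => [k /orP[] /and3P[uk dk /eqP ck] | /(_ _)/= H].
- by apply: (@count_below_inj _ d) => //; rewrite -ck.
- by rewrite ndi in dk.
- by have := H j; rewrite /arc ui dj cij eqxx.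
- by rewrite nuj in uk.
- by apply: (@count_below_inj _ u) => //; rewrite ck.
- by have := H i; rewrite /arc ui dj cij eqxx orbT.
Qed.

Let opener_arc i : u i -> arc i (f i).
Proof.
move=> ui; have : count_below u i < count_below d m.
  by rewrite total; apply: leq_trans (leq_count_below u (ltn_ord i));
     rewrite count_belowS ui addn1.
case/count_below_onto => j dj cj; have aij : arc i j by rewrite /arc ui dj cj eqxx.
by have [-> _] := arc_fun aij.
Qed.

Let closer_arc i : d i -> arc (f i) i.
Proof.
move=> di; have : count_below d i < count_below u m.
  by rewrite -total; apply: leq_trans (leq_count_below d (ltn_ord i));
     rewrite count_belowS di addn1.
case/count_below_onto => j uj cj; have aji : arc j i by rewrite /arc uj di cj eqxx.
by have [_ ->] := arc_fun aji.
Qed.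

Let flat_fun i : ~~ u i -> ~~ d i -> f i = i.
Proof.
move=> /negbTE nui /negbTE ndi; rewrite /f /nonnesting_fun; case: pickP => // k.
by rewrite /arc nui ndi andbF.
Qed.

Lemma nonnesting_funK : involutive f.
Proof.
move=> i; case: (boolP (u i)) => [/opener_arc/arc_fun[]//|nu].
case: (boolP (d i)) => [/closer_arc/arc_fun[]//|nd].
by rewrite !flat_fun.
Qed.

(** A closer [j] before [i] of the same rank would leave more closers than openers below [i],
    against [ballot]. *)
Lemma arc_lt i j : arc i j -> i < j.
Proof.
move=> /and3P[ui dj /eqP cij]; rewrite ltnNge leq_eqVlt negb_or; apply/andP; split.
  by apply/eqP => /val_inj eq_ij; have := disj i; rewrite ui -eq_ij dj.
rewrite -leqNgt leqNgt; apply/negP => /(count_below_lt dj) lt_c.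
by have := ballot (ltnW (ltn_ord i)); rewrite cij; lia.
Qed.

Lemma nonnesting_fun_gt i : (i < f i) = u i.
Proof.
case: (boolP (u i)) => [ui|nu]; first by rewrite arc_lt // opener_arc.
case: (boolP (d i)) => [di|nd]; last by rewrite flat_fun // ltnn.
by have := arc_lt (closer_arc di); lia.
Qed.

Let closer_mono i j : i < j -> d i -> d j -> f i < f j.
Proof.
move=> lt_ij di dj; have /and3P[ufi _ /eqP ci] := closer_arc di.
have /and3P[ufj _ /eqP cj] := closer_arc dj.
have := count_below_lt di lt_ij; rewrite -ci -cj ltnNge => lt_c.
by rewrite ltnNge; apply: contra lt_c; apply: leq_count_below.
Qed.

(** The delicate case is an opener [i] before a flat [j]: by [flat], as many closers as openers
    precede [j], so the partner of [i] does too. *)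
Let noncloser_mono i j : i < j -> ~~ d i -> ~~ d j -> f i < f j.
Proof.
move=> lt_ij ndi ndj.
case: (boolP (u i)) => [ui|nui]; case: (boolP (u j)) => [uj|nuj].
- have /and3P[_ dfi /eqP ci] := opener_arc ui.
  have /and3P[_ dfj /eqP cj] := opener_arc uj.
  have := count_below_lt ui lt_ij; rewrite ci cj ltnNge => lt_c.
  by rewrite ltnNge; apply: contra lt_c; apply: leq_count_below.
- have /and3P[_ dfi /eqP ci] := opener_arc ui.
  have := count_below_lt ui lt_ij; rewrite ci -flat // ltnNge => lt_c.
  by rewrite (flat_fun nuj ndj) ltnNge; apply: contra lt_c; apply: leq_count_below.
- by rewrite flat_fun //; apply: ltn_trans lt_ij _; rewrite nonnesting_fun_gt.
- by rewrite !flat_fun.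
Qed.

(** Reflection swaps openers with closers and reverses the ranks in both sets, hence maps arcs to
    arcs. *)
Let fun_rev i : f (rev_ord i) = rev_ord (f i).
Proof.
have revS (a : pred 'I_m) j :
    count_below a j + a j + count_below (fun i => a (rev_ord i)) (rev_ord j)
    = count_below a m.
  by rewrite -count_belowS -(count_below_rev a (ltn_ord j)).
have rev_arc k j : arc k j -> arc (rev_ord j) (rev_ord k).
  move=> /and3P[uk dj /eqP ckj].
  apply/and3P; split; [exact: dj | by rewrite /d rev_ordK | apply/eqP].
  have := revS u k; rewrite -/d uk; have := revS d j; rewrite dj.
  have -> : count_below (fun i => d (rev_ord i)) (rev_ord j) = count_below u (rev_ord j).
    by apply: eq_count_below => l; rewrite /d rev_ordK.
  by rewrite total ckj; lia.
case: (boolP (u i)) => [/opener_arc/rev_arc/arc_fun[]//|nu].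
case: (boolP (d i)) => [/closer_arc/rev_arc/arc_fun[]//|nd].
by rewrite !flat_fun //; rewrite /d rev_ordK.
Qed.

Definition nonnesting_perm : 'S_m := perm (inv_inj nonnesting_funK).

Lemma nonnesting_perm_excedance i : (i < nonnesting_perm i) = u i.
Proof. by rewrite permE nonnesting_fun_gt. Qed.

Lemma nonnesting_perm_in : nonnesting_perm \in ICm321 m.
Proof.
apply/ICm321P; split=> [i|i|i j k lt_ij lt_jk]; rewrite !permE.
- exact: fun_rev.
- exact: nonnesting_funK.
move=> lt_f lt_f'.
(* Two of the three positions of a 321 pattern have the same type. *)
have same (x y : 'I_m) : x < y -> d x = d y -> f x < f y.
  move=> lt_xy; case: (boolP (d y)) => [dy dx | ndy ndx].
    exact: closer_mono.
  by apply: noncloser_mono => //; rewrite ndx.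
have same_ij := same i j lt_ij; have same_jk := same j k lt_jk.
have same_ik := same i k (ltn_trans lt_ij lt_jk).
have {same_ij} : d i <> d j by move/same_ij; lia.
have {same_jk} : d j <> d k by move/same_jk; lia.
have {same_ik} : d i <> d k by move/same_ik; lia.
by case: (d i); case: (d j); case: (d k).
Qed.
End Matching.

(** * The bijection with binary words *)

Section Encoding.
Variable n : nat.
Local Open Scope nat_scope.
Local Notation m := n.*2.
Implicit Types (i : 'I_m) (b : nat -> bool).

(* The excedance word is free: at height [0] a letter [false] is a fixed point,
   and at positive height it is a deficiency. *)
Fixpoint height b k :=
  if k is k'.+1 then (if b k' then (height b k').+1 else (height b k').-1) else 0.

(** In the second half a position opens exactly when its mirror image closes, that is, carries
    [false] at positive height. *)
Definition opener b : pred 'I_m := fun i =>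
  if i < n then b i else ~~ b (rev_ord i) && (0 < height b (rev_ord i)).

Lemma eq_height b b' k : (forall l, l < k -> b l = b' l) -> height b k = height b' k.
Proof.
elim: k => //= k IHk eq_b; rewrite eq_b // IHk // => l lt_l; apply: eq_b; lia.
Qed.

Lemma eq_opener b b' : (forall k, k < n -> b k = b' k) -> opener b =1 opener b'.
Proof.
move=> eq_b i; rewrite /opener; case: ifP => [/eq_b // | ge_i].
have lt_r : rev_ord i < n by rewrite /=; have := ltn_ord i; lia.
rewrite eq_b // (@eq_height b b') // => l lt_l; apply: eq_b; lia.
Qed.

Section Opener.
Variable b : nat -> bool.
Let u := opener b.
Let d : pred 'I_m := fun i => u (rev_ord i).

Let u_half i : i < n -> u i = b i. Proof. by rewrite /u /opener => ->. Qed.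
Let d_half i : i < n -> d i = ~~ b i && (0 < height b i).
Proof.
move=> lt_i; rewrite /d /u /opener rev_ordK ifF //=; lia.
Qed.

(** The truncation of [.-1] at height 0 agrees with a flat step, which neither opens nor closes. *)
Lemma opener_count k : k <= n -> count_below u k = count_below d k + height b k.
Proof.
elim: k => [|k IHk] lt_kn; first by rewrite !count_below0.
have lt_km : k < m by lia.
have := count_belowS u (Ordinal lt_km); have := count_belowS d (Ordinal lt_km).
rewrite d_half // u_half //= => -> ->.
by have := IHk (ltnW lt_kn); case: (b k) => /=; lia.
Qed.

(** The path has the same height at [k] and at [m - k], written without subtraction; this carries
    facts over to the second half. *)
Lemma opener_count_rev k : k <= m ->
  count_below u k + count_below d (m - k) = count_below u (m - k) + count_below d k.
Proof.
move=> le_k; have := count_below_rev u le_k; have := count_below_rev u (leq_subr k m).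
rewrite subKn //; rewrite -/d; lia.
Qed.

Lemma opener_disjoint i : ~~ (u i && d i).
Proof.
have half (j : 'I_m) : j < n -> ~~ (u j && d j).
  by move=> lt_j; rewrite u_half // d_half //; case: (b j).
case: (ltnP i n) => [/half //|ge_i].
have := half (rev_ord i); rewrite /d rev_ordK andbC; apply=> /=.
by have := ltn_ord i; lia.
Qed.

Lemma opener_ballot k : k <= m -> count_below d k <= count_below u k.
Proof.
move=> le_k; case: (leqP k n) => [/opener_count -> | gt_k]; first exact: leq_addr.
by have := opener_count_rev le_k; have := @opener_count (m - k); lia.
Qed.

Lemma opener_flat i : ~~ u i -> ~~ d i -> count_below d i = count_below u i.
Proof.
have half (j : 'I_m) : j < n -> ~~ u j -> ~~ d j -> count_below d j = count_below u j.
  move=> lt_j; rewrite u_half // d_half // => /[dup] /negbTE -> -> /=.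
  by have := opener_count (ltnW lt_j); lia.
case: (ltnP i n) => [/half // | ge_i nu nd].
have lt_r : rev_ord i < n by rewrite /=; have := ltn_ord i; lia.
have := half _ lt_r nd; rewrite /d rev_ordK => /(_ nu).
(* The heights before and after the flat position [i] agree, so the symmetry may be applied at
   [i.+1], whose mirror is [rev_ord i]. *)
have := opener_count_rev (ltn_ord i); rewrite -[m - i.+1]/(rev_ord i : nat).
rewrite !count_belowS -/(d i) (negbTE nu) (negbTE nd) -/d; lia.
Qed.
End Opener.

Definition word_perm (w : seq bool) : 'S_m :=
  let b k := nth false w (n - k.+1) in
  nonnesting_perm (@opener_disjoint b).

(** The guard makes letter [n] equal to [false], the letter that follows the word in the descent
    count. *)
Definition exc (p : 'S_m) (k : nat) : bool := (k < n) && (k.+1 < pv p k.+1).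

Definition perm_word (p : 'S_m) : n.-tuple bool := Tuple (size_rev_word (exc p) n).

Lemma excE p i : i < n -> exc p i = (i < p i).
Proof. by move=> lt_i; rewrite /exc lt_i pvE. Qed.

Lemma word_perm_in w : word_perm w \in ICm321 m.
Proof. by apply: nonnesting_perm_in; [apply: opener_ballot | apply: opener_flat]. Qed.

Lemma word_permK (w : n.-tuple bool) : perm_word (word_perm w) = w.
Proof.
apply: val_inj => /=; rewrite -[RHS]rev_word_nth size_tuple; apply: eq_rev_word.
move=> k lt_k; have lt_km : k < m by lia.
by rewrite (@excE _ (Ordinal lt_km)) // nonnesting_perm_excedance;
  [rewrite /opener /= lt_k // | exact: opener_ballot].
Qed.

(** In the first half a nonexcedance is a deficiency only at positive height, by [deficient_count],
    and a fixed point only at height 0, by [fixed_count]. Symmetry settles the second half. *)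
Lemma excedance_opener p i : p \in ICm321 m -> (i < p i) = opener (exc p) i.
Proof.
move=> p_in; set U : pred 'I_m := fun i => i < p i.
set D : pred 'I_m := fun i => p i < i.
(* The height formula at [k] is a premise here because the induction proving it uses this fact at
   the same [k]. *)
have D_half (j : 'I_m) k : j = k :> nat -> k < n ->
    count_below U k = count_below D k + height (exc p) k ->
    D j = ~~ exc p k && (0 < height (exc p) k).
  move=> eq_jk; rewrite -eq_jk => lt_j c_j; rewrite excE //.
  have dC := deficient_count p_in (i := j); have fC := fixed_count p_in (i := j).
  move: dC fC; rewrite /= -/U -/D {}c_j /D.
  case: (ltngtP j (p j)) => [//|Dj /(_ isT) lt_c _|Fj _ le_c]; first by lia.
  by have := le_c (esym (val_inj Fj)); lia.
have count k : k <= n -> count_below U k = count_below D k + height (exc p) k.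
  elim: k => [|k IHk] lt_kn; first by rewrite !count_below0.
  have lt_km : k < m by lia.
  have := count_belowS U (Ordinal lt_km); have := count_belowS D (Ordinal lt_km).
  have IH := IHk (ltnW lt_kn).
  rewrite (@D_half _ k) // [U _]/U -excE //= => -> ->.
  by case: (exc p k) => /=; lia.
rewrite /opener; case: (ltnP i n) => [lt_i|ge_i]; first by rewrite excE.
have lt_r : rev_ord i < n by rewrite /=; have := ltn_ord i; lia.
rewrite -(@D_half (rev_ord i)) // /D; last by apply: count; apply: ltnW.
by rewrite -(rev_excedance p_in) rev_ordK.
Qed.

(** Both permutations have the same word by [word_permK], hence the same excedances, and these
    determine them. *)
Lemma perm_wordK p : p \in ICm321 m -> word_perm (perm_word p) = p.
Proof.
move=> p_in; have w_in := word_perm_in (perm_word p).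
have eqU i : (i < word_perm (perm_word p) i) = (i < p i).
  rewrite !excedance_opener //; apply: eq_opener => k lt_k.
  have := congr1 (fun w : n.-tuple bool => nth false w (n - k.+1))
    (word_permK (perm_word p)).
  by rewrite /= !nth_rev_word; [|lia..]; have -> : n - (n - k.+1).+1 = k by lia.
apply: (excedances_determine w_in p_in) => // i.
by rewrite -(rev_excedance w_in) -(rev_excedance p_in).
Qed.

Lemma majp_word p : p \in ICm321 m -> majp p = word_maj false (perm_word p).
Proof.
move=> p_in; rewrite /majp doubleK big_add1 /=.
have -> : false = exc p n by rewrite /exc ltnn.
rewrite word_maj_rev_word big_mkcond [RHS]big_mkcond /=.
apply: eq_big_nat => k /= lt_k; congr (if _ then _ else _).
have lt_k0 : k < m by lia. have lt_k1 : k.+1 < m by lia.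
rewrite /is_descent /=; have -> /= : k < m.-1 by lia.
have := @descentE _ p p_in (Ordinal lt_k0) (Ordinal lt_k1) erefl.
have := pvE p (Ordinal lt_k0); have := pvE p (Ordinal lt_k1) => /= -> ->.
rewrite ltnS => ->; rewrite -(@excE _ (Ordinal lt_k0)) //=.
case: (ltnP k.+1 n) => [lt_kn|ge_kn]; first by rewrite -(@excE _ (Ordinal lt_k1)).
have -> : exc p k.+1 = false by rewrite /exc ltnNge ge_kn.
(* Here [k.+1 = n], and the next position mirrors [k]: an excedance at [k] is followed by a
   deficiency, as the final letter [false] predicts. *)
have -> : Ordinal lt_k1 = rev_ord (Ordinal lt_k0) by apply: val_inj => /=; lia.
have := rev_excedance p_in (Ordinal lt_k0).
rewrite (@excE _ (Ordinal lt_k0)) //=; lia.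
Qed.
End Encoding.

Theorem mainTheorem2 (R : comNzRingType) (q : R) (n : nat) (hn : (1 <= n)%N) :
  (\sum_(p in ICm321 n.*2) q ^+ majp p
     = \sum_(0 <= h < n.+1) qbinom q n h
       + (q ^+ n - 1) * \sum_(0 <= h < n) qbinom q n.-1 h)
  /\
  (\sum_(0 <= h < n.+1) qbinom q n h
       + (q ^+ n - 1) * \sum_(0 <= h < n) qbinom q n.-1 h
     = \sum_(0 <= h < n.+1) q ^+ (n - h) * qbinom q n h).
Proof.
case: n hn => // n _; split; last by rewrite qbinom_sum_weighted.
(* The sum moves to binary words, where [majp] becomes [word_maj false]. *)
rewrite (reindex_onto (fun w : n.+1.-tuple bool => word_perm n.+1 w)
  (@perm_word n.+1)) => [|p]; last exact: perm_wordK.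
rewrite -[RHS]words_gf_false; apply: eq_big => [w|w _].
  by rewrite word_perm_in word_permK eqxx.
by rewrite majp_word ?word_perm_in // word_permK.
Qed.
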